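(* For integers $n,k$ with $n\ge 2$ and $1\le k<2^{n-1}$, the number $\sigma_{n,k}$ of separating families of $k$ proper bipartitions over an $n$-element set is $$\sigma_{n,k}=\frac{(n-1)!}{k!}\sum_{i=1}^{k}(-1)^{k-i}\left[{k+1 \atop i+1}\right]\binom{2^i-1}{n-1}.$$
   Context: A bipartition of a set $S$ is a partition of $S$ into at most two nonempty components; it is proper if it has exactly two components. A bipartition cuts two elements if they lie in different components. A family of bipartitions of $S$ is a separating family for $S$ if every two distinct elements of $S$ are cut by some bipartition in the family. $\sigma_{n,k}$ is the number of separating families consisting of $k$ distinct proper bipartitions of a fixed $n$-element set. $\left[{a \atop b}\right]$ denotes the unsigned Stirling number of the first kind (number of permutations of $a$ elements with exactly $b$ cycles). *)

(* Defs.v *)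
From mathcomp Require Import all_boot all_order all_algebra all_fingroup.

Set Implicit Arguments.
Unset Strict Implicit.
Unset Printing Implicit Defensive.

Section Bipartitions.

Variable T : finType.

(* [partition] requires the components to be nonempty. *)
Definition bipartition (P : {set {set T}}) : bool :=
  partition P [set: T] && (#|P| <= 2).

Definition proper_bipartition (P : {set {set T}}) : bool :=
  bipartition P && (#|P| == 2).

Definition cuts (P : {set {set T}}) (x y : T) : bool :=
  [exists A in P, exists B in P, [&& A != B, x \in A & y \in B]].

Definition separating_family (F : {set {set {set T}}}) : bool :=
  [forall P in F, bipartition P] &&
  [forall x, forall y, (x != y) ==> [exists P in F, cuts P x y]].

Definition sigma (k : nat) : nat :=
  #|[set F : {set {set {set T}}} |
      [&& separating_family F, [forall P in F, proper_bipartition P]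
        & #|F| == k]]|.

End Bipartitions.

(* [porbits s] is the set of cycles of [s], fixed points included. *)
Definition stirling1 (a b : nat) : nat :=
  #|[set s : 'S_a | #|porbits s| == b]|.

(* Main.v *)
(* Fix a base point [t0]. A proper bipartition is determined by its block
   avoiding [t0], so [k`! * sigma T k] counts the 0/1 matrices with rows indexed
   by ['I_k.+1] and columns indexed by [T], with row [ord0] and column [t0] zero,
   whose rows are distinct and whose columns are distinct. Distinctness of the
   rows is detected by summing signs over the permutations [s] of the rows that
   fix the matrix: the sum is 1 if the rows are distinct and 0 otherwise. After
   exchanging sums, a permutation with [c] cycles contributes, up to sign, the
   number of matrices with distinct columns all constant on its cycles; there
   are [2 ^ c.-1] such columns vanishing at [ord0], one of which is column [t0].
   Grouping the permutations by their number [c = i.+1] of cycles yields the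
   Stirling numbers. *)
Require Import Defs.
From mathcomp Require Import all_boot all_order all_algebra all_fingroup.

Set Implicit Arguments.
Unset Strict Implicit.
Unset Printing Implicit Defensive.

Import GRing.Theory.
Local Open Scope ring_scope.

(** * Injections with one prescribed value, and sign sums over stabilizers *)

(* Transposing values shows that the count does not depend on [d0] in [R], so
   it is the number of all injections into [R] divided by [#|R|]. *)
Lemma card_inj_ffuns_on_pointed (aT rT : finType) (R : {set rT}) (x0 : aT)
    (d0 : rT) :
  d0 \in R ->
  #|[set f : {ffun aT -> rT} in ffun_on R | injectiveb f && (f x0 == d0)]| =
    (#|R|.-1 ^_ #|aT|.-1)%N.
Proof.
move=> Rd0; pose S d := [set f : {ffun aT -> rT} in ffun_on R |
  injectiveb f && (f x0 == d)].
have SE d : d \in R -> #|S d| = #|S d0|.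
  move=> Rd; pose swap (f : {ffun aT -> rT}) := [ffun x => tperm d d0 (f x)].
  have swapK : involutive swap by move=> f; apply/ffunP=> x; rewrite !ffunE tpermK.
  rewrite -(card_imset _ (inv_inj swapK)); congr #|pred_of_set _|.
  (* Stated for general [a], [b] so that the pairs [(d, d0)] and [(d0, d)] give the two
     inclusions. *)
  have sub a b : a \in R -> b \in R -> (forall x, tperm d d0 x = tperm a b x) ->
      swap @: S a \subset S b.
    move=> Ra Rb tE; apply/subsetP=> _ /imsetP[f + ->].
    rewrite !inE => /and3P[/ffun_onP fR /injectiveP fI /eqP fx0].
    apply/and3P; split.
    - by apply/ffun_onP=> x; rewrite ffunE tE; case: tpermP.
    - by apply/injectiveP=> x y; rewrite !ffunE => /perm_inj/fI.
    - by rewrite ffunE tE fx0 tpermL.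
  apply/eqP; rewrite eqEsubset sub //=; apply/subsetP=> f fS.
  rewrite -[f]swapK imset_f // (subsetP (sub d0 d _ _ _)) ?imset_f // => x.
  by rewrite tpermC.
have cR : (0 < #|R|)%N by apply/card_gt0P; exists d0.
have cT : (0 < #|aT|)%N by apply/card_gt0P; exists x0.
have : (#|R| * #|S d0| = #|R| ^_ #|aT|)%N.
  rewrite -card_inj_ffuns_on -sum_nat_const -(eq_bigr _ SE).
  rewrite -[RHS]sum1_card (partition_big (fun f : {ffun _ -> _} => f x0) (mem R)) /=.
    apply: eq_bigr => d Rd; rewrite -sum1_card; apply: eq_bigl => f.
    by rewrite !inE andbA.
  by move=> f; rewrite inE => /andP[/ffun_onP].
by rewrite -(prednK cR) -(prednK cT) ffactSS => /eqP; rewrite eqn_mul2l => /eqP.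
Qed.

(* If [f x = f y] with [x != y], left multiplication by the transposition of
   [x] and [y] is a sign-reversing involution of the stabilizer of [f]. *)
Lemma sum_sign_stabilizer (aT : finType) (rT : eqType) (f : aT -> rT) :
  \sum_(s : {perm aT} | [forall x, f (s x) == f x]) (-1) ^+ s =
    (injectiveb f)%:R :> rat.
Proof.
case: injectiveP => [fI | /injectiveP fnI].
  rewrite (big_pred1 1%g) ?odd_perm1 // => s; apply/forallP/eqP=> [fs | -> x].
    by apply/permP=> x; rewrite perm1; apply/fI/eqP.
  by rewrite perm1.
have /injectivePn[x [y nxy fxy]] := fnI.
have ft z : f (tperm x y z) = f z by case: tpermP => [->|->|].
set S := \sum_(s | _) _; suff: S = - S.
  by move/eqP; rewrite -addr_eq0 -mulr2n Num.Theory.mulrn_eq0 => /eqP.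
rewrite {1}/S (reindex_inj (mulgI (tperm x y))) /= -sumrN.
apply: eq_big => [s | s _]; last first.
  by rewrite odd_permM odd_tperm nxy addTb signrN.
apply/forallP/forallP=> h z.
  by have := h (tperm x y z); rewrite permM tpermK ft.
by rewrite permM (eqP (h _)) ft.
Qed.

(** * Cycles of a permutation: sign and invariant sets *)

Lemma card_porbits_le (a : nat) (s : 'S_a) : (#|porbits s| <= a)%N.
Proof. by rewrite -[leqRHS]card_ord; apply: leq_imset_card. Qed.

Lemma sign_perm_porbits (a : nat) (s : 'S_a) :
  (-1) ^+ s = (-1) ^+ (a - #|porbits s|) :> rat.
Proof.
by rewrite -[RHS]signr_odd oddB ?card_porbits_le // /odd_perm card_ord.
Qed.

(** An invariant set is a union of cycles, and avoiding [x0] excludes exactly the cycle of [x0]; any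
    subset of the remaining cycles may be chosen. *)
Lemma card_invariant_sets (aT : finType) (s : {perm aT}) (x0 : aT) :
  #|[set A : {set aT} | (x0 \notin A) &&
      [forall x, (s x \in A) == (x \in A)]]| = (2 ^ #|porbits s|.-1)%N.
Proof.
have dec A : [forall x, (s x \in A) == (x \in A)] ->
    forall x y, y \in porbit s x -> (y \in A) = (x \in A).
  move=> /forallP sA x y /porbitP[i ->].
  elim: i => [|i IH]; first by rewrite expg0 perm1.
  by rewrite expgSr permM (eqP (sA _)).
have porb0 : porbit s x0 \in porbits s by apply: imset_f.
have -> : (#|porbits s|.-1 = #|porbits s :\ porbit s x0|)%N.
  by rewrite (cardsD1 (porbit s x0) (porbits s)) porb0.
rewrite -card_powerset.
pose q (A : {set aT}) := [set porbit s x | x in A].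
rewrite -(card_in_imset (f := q)); last first.
  move=> A B; rewrite !inE => /andP[_ /dec dA] /andP[_ /dec dB] qAB.
  apply/setP=> x; apply/idP/idP=> h.
    have : porbit s x \in q B by rewrite -qAB imset_f.
    case/imsetP=> y By xy; rewrite (dB y) //; by rewrite -xy porbit_id.
  have : porbit s x \in q A by rewrite qAB imset_f.
  case/imsetP=> y By xy; rewrite (dA y) //; by rewrite -xy porbit_id.
congr #|pred_of_set _|; apply/setP=> Q; rewrite powersetE.
apply/imsetP/idP=> [[A] |].
  rewrite inE => /andP[x0A /dec dA ->]; apply/subsetP=> _ /imsetP[x Ax ->].
  rewrite !inE imset_f // andbT; apply: contra x0A => /eqP xx0.
  by rewrite (dA x) // xx0 porbit_id.
(* The inverse of [q] takes the union of the cycles in [Q]. *)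
move=> sQ; exists [set x | porbit s x \in Q].
  rewrite !inE; apply/andP; split.
    by apply/negP=> /(subsetP sQ); rewrite !inE eqxx.
  apply/forallP=> x; rewrite !inE; apply/eqP; congr (_ \in Q).
  by apply/eqP; rewrite eq_porbit_mem; exact: (mem_porbit s 1 x).
apply/setP=> X; apply/idP/imsetP=> [QX | [x]]; last by rewrite inE => ? ->.
have /(subsetP sQ) := QX; rewrite !inE => /andP[_ /imsetP[x _ XE]].
by exists x; rewrite ?inE -?XE.
Qed.

(** * Matrices fixed by a permutation of the rows *)

(* Row [i] of the 0/1 matrix is [h i]; the second condition says that column
   [t0] is zero. *)
Definition separating_rows (T : finType) (k : nat) (t0 : T) :=
  [set h : {ffun 'I_k.+1 -> {set T}} | [&& h ord0 == set0,
    [forall i, t0 \notin h i] &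
    injectiveb [ffun t : T => [set i | t \in h i]]]].

(** Read by columns, the matrix is an injection from [T] into the [s]-invariant sets of row indices
    avoiding [ord0], with [t0] sent to [set0]. *)
Lemma card_separating_rows_invariant (T : finType) (k : nat) (t0 : T)
    (s : 'S_k.+1) :
  #|[set h in separating_rows k t0 | [forall i, h (s i) == h i]]| =
    ((2 ^ #|porbits s|.-1).-1 ^_ #|T|.-1)%N.
Proof.
rewrite -(card_invariant_sets s ord0); set R := [set A : {set 'I_k.+1} | _].
have R0 : set0 \in R.
  by rewrite !inE /=; apply/forallP=> x; rewrite !inE.
rewrite -(card_inj_ffuns_on_pointed t0 R0).
(* Matrix transposition: a family of rows becomes the family of columns. *)
pose tr (A B : finType) (h : {ffun A -> {set B}}) :=
  [ffun t : B => [set i | t \in h i]].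
have trK A B : cancel (@tr A B) (@tr B A).
  by move=> h; apply/ffunP=> i; apply/setP=> t; rewrite !(ffunE, inE).
rewrite -(card_imset _ (can_inj (@trK _ _))); congr #|pred_of_set _|.
apply/setP=> g; rewrite -[g]trK (mem_imset _ _ (can_inj (@trK _ _))).
move: (tr _ _ g) => h; rewrite [LHS]inE [in LHS]inE [in RHS]inE -/(tr _ _ h).
case: (injectiveb _); rewrite ?(andbF, andbT) //=.
apply/andP/andP=> [[/andP[/eqP h0 /forallP ht0] /forallP hs] | [/ffun_onP hR /eqP ht0]].
  split; last by apply/eqP/setP=> i; rewrite ffunE !inE (negPf (ht0 i)).
  apply/ffun_onP=> t; rewrite ffunE !inE h0 inE; apply/forallP=> i.
  by rewrite !inE (eqP (hs i)).
have hR' t : (t \notin h ord0) && [forall i, (t \in h (s i)) == (t \in h i)].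
  have := hR t; rewrite ffunE !inE => /andP[-> /forallP hs]; apply/forallP=> i.
  by have := hs i; rewrite !inE.
split; last first.
  apply/forallP=> i; apply/eqP/setP=> t.
  by have /andP[_ /forallP/(_ i)/eqP] := hR' t.
apply/andP; split.
  by apply/eqP/setP=> t; rewrite inE; apply/negbTE; case/andP: (hR' t).
by apply/forallP=> i; move/setP/(_ i): ht0; rewrite ffunE !inE => ->.
Qed.

(** * Bipartitions encoded by their block avoiding the base point *)

Definition bip (T : finType) (A : {set T}) : {set {set T}} := [set A; ~: A].

Lemma cuts_bip (T : finType) (A : {set T}) (x y : T) :
  cuts (bip A) x y = ((x \in A) != (y \in A)).
Proof.
have nAC : A != ~: A by apply/eqP=> /setP/(_ x); rewrite inE; case: (x \in A).
apply/existsP/idP=> [[B /andP[+ /existsP[C /andP[]]]] |].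
  by rewrite !inE => /orP[]/eqP-> /orP[]/eqP-> /and3P[]; rewrite ?eqxx //= !inE;
    case: (x \in A); case: (y \in A).
case xA: (x \in A); case yA: (y \in A) => // _.
  exists A; rewrite !inE eqxx; apply/existsP; exists (~: A).
  by rewrite !inE eqxx orbT nAC xA yA.
exists (~: A); rewrite !inE eqxx orbT; apply/existsP; exists A.
by rewrite !inE eqxx /= eq_sym nAC xA yA.
Qed.

Lemma proper_bip (T : finType) (A : {set T}) :
  A != set0 -> A != setT -> proper_bipartition (bip A).
Proof.
move=> A0 AT; have nAC : A != ~: A.
  by apply: contraNneq A0 => eqAC; rewrite -(setIid A) {2}eqAC setICr.
rewrite /proper_bipartition /bipartition cards2 nAC !andbT.
rewrite /partition /trivIset /cover !big_setU1 ?inE //= !big_set1 setUCr eqxx.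
rewrite cardsC -cardsT eqxx /= negb_or eq_sym A0 /=.
by rewrite eq_sym -setCT (inj_eq (@setC_inj T)).
Qed.

(** The witness is the block other than that of [t0]; two disjoint blocks covering [T] are
    complementary. *)
Lemma proper_bipartitionP (T : finType) (t0 : T) (P : {set {set T}}) :
  proper_bipartition P ->
  exists2 A : {set T}, (A != set0) && (t0 \notin A) & P = bip A.
Proof.
move=> /andP[/andP[partP _] P2].
have covP : cover P = setT by apply/eqP; case/and3P: partP.
have Pt0 : pblock P t0 \in P by rewrite pblock_mem // covP inE.
have [B BP PE] : exists2 B, B \in P :\ pblock P t0 & P :\ pblock P t0 = [set B].
  have /cards1P[B BE] : #|P :\ pblock P t0| == 1.
    by move: P2; rewrite (cardsD1 (pblock P t0)) Pt0.
  by exists B; rewrite ?BE ?inE.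
have P0 : P = [set pblock P t0; B] by rewrite -PE setD1K.
have tP : trivIset P by case/and3P: partP.
move: BP; rewrite !inE => /andP[nB BP].
have dis : [disjoint pblock P t0 & B].
  by move/trivIsetP: tP; apply => //; rewrite eq_sym.
have t0t0 : t0 \in pblock P t0 by rewrite mem_pblock covP inE.
have BE : pblock P t0 = ~: B.
  apply/eqP; rewrite eqEsubset -disjoints_subset dis /=.
  apply/subsetP=> x; rewrite inE => nxB.
  have : x \in cover P by rewrite covP inE.
  rewrite /cover => /bigcupP[C CP xC].
  have := CP; rewrite {1}P0 !inE => /orP[]/eqP CE; first by rewrite -CE.
  by rewrite -CE xC in nxB.
exists B; last by rewrite {1}P0 BE setUC.
rewrite (disjointFr dis) // andbT.
by apply: contraTneq BP => ->; case/and3P: partP.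
Qed.

(** These are the sets of rows of the matrices; [set0] stands for the zero row [ord0]. *)
Definition separating_sets (T : finType) (t0 : T) :=
  [set G : {set {set T}} | [&& set0 \in G, [forall A in G, t0 \notin A] &
    [forall x, forall y, (x != y) ==>
      [exists A in G, (x \in A) != (y \in A)]]]].

(** Dropping [set0] and completing each other set by its complement is a bijection onto separating
    families; it lowers the cardinal by one. *)
Lemma sigma_separating_sets (T : finType) (t0 : T) (k : nat) :
  sigma T k = #|[set G in separating_sets t0 | #|G| == k.+1]|.
Proof.
(* Equal values of [bip] leave equal or complementary sets, and complementary ones cannot both avoid
   [t0]. *)
have bip_inj : {in [pred A : {set T} | t0 \notin A] &, injective (@bip T)}.
  move=> A B At0 Bt0 AB; have : A \in bip B by rewrite -AB !inE eqxx.
  rewrite !inE => /orP[]/eqP // AE.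
  by move: At0; rewrite inE AE !inE (negPf Bt0).
pose phi (G : {set {set T}}) := @bip T @: (G :\ set0).
have phi_card (G : {set {set T}}) :
    set0 \in G -> [forall A in G, t0 \notin A] -> #|phi G|.+1 = #|G|.
  move=> G0 /forall_inP Gt0; rewrite card_in_imset; last first.
    by move=> A B /setD1P[_ /Gt0 At0] /setD1P[_ /Gt0 Bt0]; apply: bip_inj.
  by rewrite (cardsD1 set0 G) G0.
have phi_mem (G : {set {set T}}) (A : {set T}) : [forall A in G, t0 \notin A] -> t0 \notin A ->
    (bip A \in phi G) = (A \in G :\ set0).
  move=> /forall_inP Gt0 At0; apply/imsetP/idP=> [[B BG /bip_inj ->] | AG] //.
    by apply: Gt0; case/setD1P: BG.
  by exists A.
(* Removing [set0] is harmless, since it separates no two points. *)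
have sepE (G : {set {set T}}) x y :
    [exists P in phi G, cuts P x y] = [exists A in G, (x \in A) != (y \in A)].
  apply/exists_inP/exists_inP=> [[P /imsetP[A AG ->]] | [A AG Axy]].
    by rewrite cuts_bip => Axy; exists A => //; case/setD1P: AG.
  exists (bip A); last by rewrite cuts_bip.
  apply: imset_f; rewrite in_setD1 AG andbT.
  by apply: contraNneq Axy => ->; rewrite !inE.
rewrite -(card_in_imset (f := phi)); last first.
  move=> G H; rewrite !inE => /andP[/and3P[G0 Gt0 _] _] /andP[/and3P[H0 Ht0 _] _] GH.
  apply/setP=> A; case: (eqVneq A set0) => [-> | A0]; first by rewrite G0 H0.
  case: (boolP (t0 \in A)) => At0.
    apply/idP/idP=> [/(forall_inP Gt0) | /(forall_inP Ht0)]; by rewrite At0.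
  by have := phi_mem G A Gt0 At0; rewrite GH phi_mem // !inE A0.
congr #|pred_of_set _|; apply/setP=> F; rewrite [LHS]inE.
apply/and3P/imsetP=> [[/andP[_ sepF] /forall_inP propF /eqP cF] | [G]]; last first.
  rewrite !inE => /andP[/and3P[G0 Gt0 sepG] /eqP cG] ->.
  have prop P : P \in phi G -> proper_bipartition P.
    case/imsetP=> A /setD1P[A0 /(forall_inP Gt0) At0] ->; apply: proper_bip => //.
    by apply: contraNneq At0 => ->.
  split; last by rewrite -eqSS phi_card // cG.
    apply/andP; split; first by apply/forall_inP=> P /prop/andP[].
    apply/forallP=> x; apply/forallP=> y; rewrite sepE.
    by move/forallP/(_ x)/forallP/(_ y): sepG.
  exact/forall_inP.
(* The preimage of [F]: the blocks avoiding [t0], with [set0] adjoined. *)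
pose G := [set A : {set T} | (t0 \notin A) && ((A == set0) || (bip A \in F))].
have G0 : set0 \in G by rewrite !inE eqxx.
have Gt0 : [forall A in G, t0 \notin A].
  by apply/forall_inP=> A; rewrite inE => /andP[].
have FE : F = phi G.
  apply/setP=> P; apply/idP/imsetP=> [PF | [A + ->]].
    have [A /andP[A0 At0] PE] := proper_bipartitionP t0 (propF P PF).
    by exists A => //; rewrite !inE A0 At0 -PE PF orbT.
  by rewrite !inE; case: (A == set0) => //= /andP[].
exists G => //; rewrite in_set -phi_card // -FE cF eqxx andbT inE G0 Gt0 /=.
apply/forallP=> x; apply/forallP=> y; rewrite -sepE -FE.
by move/forallP/(_ x)/forallP/(_ y): sepF.
Qed.

Lemma card_separating_rows_inj (T : finType) (t0 : T) (k : nat) :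
  #|[set h in separating_rows k t0 | injectiveb h]| = (k`! * sigma T k)%N.
Proof.
rewrite (sigma_separating_sets t0) mulnC -sum_nat_const -sum1_card.
pose im (h : {ffun 'I_k.+1 -> {set T}}) := [set h i | i : 'I_k.+1].
have rowsE (h : {ffun 'I_k.+1 -> {set T}}) : injectiveb h ->
    (h \in separating_rows k t0) =
    (h ord0 == set0) && (im h \in separating_sets t0).
  move=> /injectiveP hI; rewrite !inE; case: eqVneq => //= h0.
  have -> /= : set0 \in im h by rewrite -h0 imset_f.
  congr (_ && _).
    apply/forallP/forall_inP=> [ht0 _ /imsetP[i _ ->] // | ht0 i].
    by apply: ht0; apply: imset_f.
  apply/injectiveP/forallP=> [cI x | sep x y].
    apply/forallP=> y; apply/implyP=> nxy.
    have /eqP/setP nE : [ffun t => [set i | t \in h i]] x !=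
        [ffun t => [set i | t \in h i]] y by rewrite (inj_eq cI).
    have /existsP[i hi] : [exists i, (x \in h i) != (y \in h i)].
      apply/contraT; rewrite negb_exists => /forallP al.
      case: nE => i; rewrite !ffunE !inE; apply/eqP; exact/negPn/al.
    by apply/exists_inP; exists (h i); rewrite ?imset_f.
  rewrite !ffunE => /setP E; apply/eqP/contraT=> nxy.
  have /forallP/(_ y)/implyP/(_ nxy)/exists_inP[_ /imsetP[i _ ->]] := sep x.
  by have := E i; rewrite !inE => ->; rewrite eqxx.
(* Each fibre of [im] consists of the injections into [G] sending [ord0] to [set0]. *)
rewrite (partition_big im [in [set G in separating_sets t0 | #|G| == k.+1]]) /=.
  apply: eq_bigr => G; rewrite inE => /andP[sG /eqP cG].
  have G0 : set0 \in G by move: sG; rewrite inE => /and3P[].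
  rewrite sum1_card -ffactnn.
  have := card_inj_ffuns_on_pointed (ord0 : 'I_k.+1) G0.
  rewrite cG card_ord /= => <-; apply: eq_card => h; rewrite [LHS]unfold_in !inE.
  case: (boolP (injectiveb h)) => hI; last by rewrite !(andbF, andbT).
  have := rowsE h hI; rewrite inE => ->; rewrite andbT /= andbC.
  case: (h ord0 == set0); rewrite ?andbF //= andbT.
  have cim : #|im h| = k.+1 by rewrite card_imset ?card_ord //; apply/injectiveP.
  apply/andP/ffun_onP=> [[/eqP <- _ i] | hG]; first exact: imset_f.
  suff imG : im h = G by rewrite imG eqxx.
  apply/eqP; rewrite eqEcard cim cG leqnn andbT.
  by apply/subsetP=> _ /imsetP[i _ ->].
move=> h; rewrite inE => /andP[hr hI]; move: hr; rewrite rowsE // => /andP[_ hs].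
by rewrite inE hs /= card_imset ?card_ord //; apply/injectiveP.
Qed.

(** * Signed summation by number of cycles *)

Theorem theorem3p12 (n k : nat) (T : finType) (hT : #|T| = n) (hn : (2 <= n)%N)
    (hk1 : (1 <= k)%N) (hk2 : (k < 2 ^ (n - 1))%N) :
  (sigma T k)%:R =
    ((n - 1)`!)%:R / (k`!)%:R *
    \sum_(1 <= i < k.+1)
      (-1) ^+ (k - i) * (stirling1 k.+1 i.+1)%:R * ('C(2 ^ i - 1, n - 1))%:R
  :> rat.
Proof.
have /card_gt0P[t0 _] : (0 < #|T|)%N by rewrite hT (ltn_trans _ hn).
have kN0 : (k`!)%:R != 0 :> rat by rewrite Num.Theory.pnatr_eq0 -lt0n fact_gt0.
apply: (mulfI kN0); rewrite -natrM -(card_separating_rows_inj t0).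
rewrite mulrA mulrCA divff // mulr1.
have -> : #|[set h in separating_rows k t0 | injectiveb h]|%:R =
    \sum_(h in separating_rows k t0) \sum_(s : 'S_k.+1 |
      [forall i, h (s i) == h i]) (-1) ^+ s :> rat.
  rewrite -sum1_card natr_sum; under [RHS]eq_bigr do rewrite sum_sign_stabilizer.
  rewrite big_mkcond [RHS]big_mkcond; apply: eq_bigr => h _; rewrite inE.
  by case: (h \in _) => //=; case: (injectiveb h).
rewrite (exchange_big_dep xpredT) //=.
transitivity (\sum_(s : 'S_k.+1) (-1) ^+ (k.+1 - #|porbits s|) *
    ((2 ^ #|porbits s|.-1).-1 ^_ n.-1)%:R : rat).
  apply: eq_bigr => s _; rewrite sign_perm_porbits sumr_const -[LHS]mulr_natr.
  rewrite -hT -(card_separating_rows_invariant t0); congr (_ * _%:R).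
  by apply: eq_card => h; rewrite [LHS]unfold_in [RHS]inE.
have porb_gt0 (s : 'S_k.+1) : (0 < #|porbits s|)%N.
  by apply/card_gt0P; exists (porbit s ord0); apply: imset_f.
have porb_le (s : 'S_k.+1) : (#|porbits s|.-1 < k.+1)%N.
  by rewrite prednK // card_porbits_le.
(* The class index is the number of cycles minus one, hence at most [k]. *)
rewrite (partition_big (fun s : 'S_k.+1 => Ordinal (porb_le s)) xpredT) //=.
rewrite -(big_mkord xpredT (fun i => \sum_(s : 'S_k.+1 | #|porbits s|.-1 == i)
  (-1) ^+ (k.+1 - #|porbits s|) * ((2 ^ #|porbits s|.-1).-1 ^_ n.-1)%:R)).
(* For [i = 0] there are [2 ^ 0 - 1 = 0] columns available for the [n - 1 > 0] points other than
   [t0], so the term vanishes. *)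
rewrite big_ltn // big1 ?add0r => [|s /eqP ->]; last first.
  by rewrite expn0 ffact_small ?mulr0 //; case: (n) hn => [|[]].
rewrite mulr_sumr; apply: eq_bigr => i _.
rewrite mulrCA -natrM mulnC -!subn1 bin_ffact -mulrA.
rewrite [in RHS]mulrA.
(* The summand is constant on a class, whose size is the Stirling number. *)
rewrite (eq_bigr (fun=> (-1) ^+ (k - i) * ((2 ^ i - 1) ^_ (n - 1))%:R)).
  rewrite sumr_const -[LHS]mulr_natr [RHS]mulrAC; congr (_ * _%:R).
  apply: eq_card => s.
  by rewrite [LHS]unfold_in [RHS]inE -[in RHS](prednK (porb_gt0 s)).
move=> s /eqP si; rewrite si -[in LHS](prednK (porb_gt0 s)) si subSS.
by rewrite !subn1.
Qed.
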